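(* Thompson's group $T$ is not invariably generated.
   Context: $S^1$ is the interval $[0,1]$ with $0$ and $1$ identified. Thompson's group $T$ is the group of piecewise linear orientation-preserving homeomorphisms of $S^1$ which preserve the set of finite dyadic fractions, have finitely many breakpoints, all at finite dyadic fractions, and all slopes integer powers of $2$. A group $G$ is invariably generated if there is a subset $S\subseteq G$ such that $G=\langle s^{g(s)}: s\in S\rangle$ for every choice of $g(s)\in G$, $s\in S$; equivalently, no proper subgroup of $G$ meets every conjugacy class of $G$. *)

(* Defs.v *)
From Stdlib Require Import Reals ZArith Lra.
Open Scope R_scope.

(** The circle S^1 = [0,1) with 0 and 1 identified, represented by [0,1). *)
Definition S1 : Type := { x : R | 0 <= x < 1 }.

Definition dyadic (x : R) : Prop :=
  exists (m : Z) (k : nat), x = IZR m / 2 ^ k.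

(** Fractional part: y - floor y, with floor y = up y - 1. *)
Definition frac (y : R) : R := y - IZR (up y) + 1.

(** F : R -> R is a lift of a piecewise linear orientation-preserving
    homeomorphism of S^1 with finitely many breakpoints, all dyadic,
    slopes integer powers of 2, preserving the dyadic fractions. *)
Definition T_lift (F : R -> R) : Prop :=
  (forall x, F (x + 1) = F x + 1) /\
  (forall x, dyadic x <-> dyadic (F x)) /\
  exists (n : nat) (a : nat -> R) (k : nat -> Z) (b : nat -> R),
    a 0%nat = 0 /\ a n = 1 /\
    (forall i, (i <= n)%nat -> dyadic (a i)) /\
    (forall i, (i < n)%nat -> a i < a (S i)) /\
    (forall i, (i < n)%nat -> forall x, a i <= x <= a (S i) ->
        F x = powerRZ 2 (k i) * x + b i).

Definition ThompsonT (h : S1 -> S1) : Prop :=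
  exists F : R -> R, T_lift F /\ forall x : S1, proj1_sig (h x) = frac (F (proj1_sig x)).

Definition is_subgroup (H : (S1 -> S1) -> Prop) : Prop :=
  (forall f, H f -> ThompsonT f) /\
  H (fun x => x) /\
  (forall f g, H f -> H g -> H (fun x => f (g x))) /\
  (forall f, H f -> exists f', H f' /\ forall x, f (f' x) = x /\ f' (f x) = x).

Definition generated (A : (S1 -> S1) -> Prop) (f : S1 -> S1) : Prop :=
  forall H, is_subgroup H -> (forall a, A a -> H a) -> H f.

(** The conjugate s^g = g^{-1} s g, characterised by g ∘ s^g = s ∘ g. *)
Definition conj_by (s g c : S1 -> S1) : Prop :=
  forall x, g (c x) = s (g x).

Definition T_invariably_generated : Prop :=
  exists S : (S1 -> S1) -> Prop,
    (forall s, S s -> ThompsonT s) /\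
    forall g : (S1 -> S1) -> (S1 -> S1),
      (forall s, S s -> ThompsonT (g s)) ->
      forall f, ThompsonT f ->
        generated (fun c => exists s, S s /\ ThompsonT c /\ conj_by s (g s) c) f.

(* Main.v *)
Require Import Defs.
From Stdlib Require Import Reals ZArith Lra Lia Cantor.
From Stdlib Require Import Classical ClassicalEpsilon FunctionalExtensionality
  ProofIrrelevance.

(** Each element [s] of T has a dyadic interval [B] such that, for every [n],
    either [s ^ n] is the identity or [s ^ n B] is disjoint from [B]. If some
    dyadic point has an infinite orbit, this orbit eventually avoids the dyadics
    of small denominator, so a small standard dyadic interval starting at one of
    its points is mapped affinely to standard dyadic intervals by all positive
    powers of [s]; these intervals are pairwise nested or disjoint, and [B] is
    found by removing the first return. Otherwise all dyadic points are periodic,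
    [s] has finite order, and [B] is a small interval at [0].

    T is countable, and the complement of [B] can be squeezed by an element of T
    into any prescribed arc. Conjugating the elements of the given set so that
    these complements land in pairwise disjoint arcs of [1/2, 1), the conjugates
    play ping-pong: every nontrivial element of the group they generate maps
    [0, 1/2) into one of the arcs. A nontrivial element of T fixing [0] is
    therefore not in this group. *)

(** * Powers of two, floors and fractional parts *)

Lemma pow2_pos k : 0 < 2 ^ k.
Proof. apply pow_lt; lra. Qed.

Lemma pow2_neq0 k : 2 ^ k <> 0.
Proof. pose proof (pow2_pos k); lra. Qed.

#[local] Hint Resolve pow2_pos pow2_neq0 : core.

Lemma IZR_pow2 k : IZR (2 ^ Z.of_nat k) = 2 ^ k.
Proof. rewrite <- pow_IZR; reflexivity. Qed.

Lemma div_le_iff a b c : 0 < c -> (a / c <= b <-> a <= b * c).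
Proof.
  intros Hc; split; intros H.
  - apply (Rmult_le_compat_r c) in H; [|lra].
    unfold Rdiv in H; rewrite Rmult_assoc, Rinv_l in H; lra.
  - apply (Rmult_le_reg_r c); [lra|].
    unfold Rdiv; rewrite Rmult_assoc, Rinv_l; lra.
Qed.

Lemma lt_div_iff a b c : 0 < c -> (b < a / c <-> b * c < a).
Proof.
  intros Hc; pose proof (div_le_iff a b c Hc); split; intros H'.
  - apply Rnot_le_lt; intros Hl; apply H in Hl; lra.
  - apply Rnot_le_lt; intros Hl; apply H in Hl; lra.
Qed.

Lemma le_div_iff a b c : 0 < c -> (b <= a / c <-> b * c <= a).
Proof.
  intros Hc; split; intros H.
  - apply (Rmult_le_compat_r c) in H; [|lra].
    unfold Rdiv in H; rewrite Rmult_assoc, Rinv_l in H; lra.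
  - apply (Rmult_le_reg_r c); [lra|].
    unfold Rdiv; rewrite Rmult_assoc, Rinv_l; lra.
Qed.

Lemma div_lt_iff a b c : 0 < c -> (a / c < b <-> a < b * c).
Proof.
  intros Hc; pose proof (le_div_iff a b c Hc); split; intros H'.
  - apply Rnot_le_lt; intros Hl; apply H in Hl; lra.
  - apply Rnot_le_lt; intros Hl; apply H in Hl; lra.
Qed.

Lemma floor_exists y : exists m : Z, IZR m <= y < IZR m + 1.
Proof.
  destruct (archimed y) as [H1 H2]; exists (up y - 1)%Z.
  rewrite minus_IZR; lra.
Qed.

Lemma IZR_lt_succ a b : IZR a < IZR b + 1 -> (a <= b)%Z.
Proof. rewrite <- plus_IZR; intros H; apply lt_IZR in H; lia. Qed.

Lemma floor_unique a b x y :
  IZR a <= x < IZR a + 1 -> IZR b <= y < IZR b + 1 -> x = y -> a = b.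
Proof.
  intros Ha Hb ->.
  assert (a <= b)%Z by (apply IZR_lt_succ; lra).
  assert (b <= a)%Z by (apply IZR_lt_succ; lra).
  lia.
Qed.

Lemma frac_spec y : exists z, y = IZR z + frac y /\ 0 <= frac y < 1.
Proof.
  destruct (archimed y); exists (up y - 1)%Z; unfold frac.
  rewrite minus_IZR; lra.
Qed.

Lemma frac_unique z r y : 0 <= r < 1 -> y = IZR z + r -> frac y = r.
Proof.
  intros Hr Hy; destruct (frac_spec y) as (z' & Hz & Hf).
  assert (z = z') by (eapply floor_unique with (x := y) (y := y); lra).
  subst z'; lra.
Qed.

Lemma frac_bounds y : 0 <= frac y < 1.
Proof. destruct (frac_spec y) as (z & _ & H); exact H. Qed.

Lemma frac_id y : 0 <= y < 1 -> frac y = y.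
Proof. intros; apply (frac_unique 0); lra. Qed.

(** * Dyadic numbers *)

Lemma dyadic_intro m k : dyadic (IZR m / 2 ^ k).
Proof. exists m, k; reflexivity. Qed.

Lemma dyadic_eventually d : dyadic d ->
  exists k0, forall k, (k0 <= k)%nat -> exists z, d = IZR z / 2 ^ k.
Proof.
  intros (m & k0 & ->); exists k0; intros k Hk.
  exists (m * 2 ^ Z.of_nat (k - k0))%Z.
  rewrite mult_IZR, IZR_pow2.
  replace k with (k0 + (k - k0))%nat at 2 by lia.
  rewrite pow_add; field; auto.
Qed.

Lemma dyadic_IZR z : dyadic (IZR z).
Proof. exists z, 0%nat; simpl; field. Qed.

Lemma dyadic_plus x y : dyadic x -> dyadic y -> dyadic (x + y).
Proof.
  intros Hx Hy.
  apply dyadic_eventually in Hx; apply dyadic_eventually in Hy.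
  destruct Hx as [k Hx], Hy as [l Hy].
  destruct (Hx (k + l)%nat ltac:(lia)) as [a ->].
  destruct (Hy (k + l)%nat ltac:(lia)) as [b ->].
  exists (a + b)%Z, (k + l)%nat; rewrite plus_IZR; field; auto.
Qed.

Lemma dyadic_mult x y : dyadic x -> dyadic y -> dyadic (x * y).
Proof.
  intros (a & k & ->) (b & l & ->).
  exists (a * b)%Z, (k + l)%nat; rewrite mult_IZR, pow_add; field; auto.
Qed.

Lemma dyadic_opp x : dyadic x -> dyadic (- x).
Proof.
  intros (a & k & ->); exists (- a)%Z, k; rewrite opp_IZR; field; auto.
Qed.

Lemma dyadic_pow2 k : dyadic (2 ^ k).
Proof. rewrite <- IZR_pow2; apply dyadic_IZR. Qed.

Lemma dyadic_div_pow2 x k : dyadic x -> dyadic (x / 2 ^ k).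
Proof.
  intros Hx; replace (x / 2 ^ k) with (x * (IZR 1 / 2 ^ k)) by (field; auto).
  apply dyadic_mult; [exact Hx | apply dyadic_intro].
Qed.

Lemma powerRZ_2_quotient N K :
  powerRZ 2 (Z.of_nat N - Z.of_nat K) = 2 ^ N / 2 ^ K.
Proof.
  unfold Zminus; rewrite powerRZ_add by lra.
  rewrite powerRZ_neg', <- !pow_powerRZ; reflexivity.
Qed.

Lemma exists_pow2_gt x : exists k, x < 2 ^ k.
Proof.
  destruct (Pow_x_infinity 2 ltac:(rewrite Rabs_pos_eq; lra) (x + 1)) as [k Hk].
  exists k; specialize (Hk k (le_n k)).
  rewrite Rabs_pos_eq in Hk; [lra|]. left; auto.
Qed.

Lemma exists_inv_pow2_lt e : 0 < e -> exists k, 1 / 2 ^ k < e.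
Proof.
  intros He; destruct (exists_pow2_gt (1 / e)) as [k Hk].
  exists k; apply div_lt_iff; auto.
  apply div_lt_iff in Hk; lra.
Qed.

Lemma dyadic_dense x y : x < y -> exists m k, x < IZR m / 2 ^ k < y.
Proof.
  intros Hxy; destruct (exists_inv_pow2_lt (y - x)) as [k Hk]; [lra|].
  destruct (floor_exists (x * 2 ^ k)) as [m Hm].
  exists (m + 1)%Z, k; rewrite plus_IZR.
  apply div_lt_iff in Hk; auto.
  split; [apply lt_div_iff | apply div_lt_iff]; auto; lra.
Qed.

(** Provides one mesh that suits finitely many pieces or points at once. *)
Lemma eventually_uniform (P : nat -> nat -> Prop) n :
  (forall i, (i < n)%nat -> exists N0, forall N, (N0 <= N)%nat -> P i N) ->
  exists N0, forall N, (N0 <= N)%nat -> forall i, (i < n)%nat -> P i N.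
Proof.
  induction n as [|n IH]; intros H.
  - exists 0%nat; intros; lia.
  - destruct IH as [N1 H1]; [intros; apply H; lia|].
    destruct (H n) as [N2 H2]; [lia|].
    exists (N1 + N2)%nat; intros N HN i Hi.
    destruct (Nat.eq_dec i n) as [->|]; [apply H2 | apply H1]; lia.
Qed.

Lemma discrete_crossing (u : nat -> R) y n :
  u 0%nat <= y < u n -> exists i, (i < n)%nat /\ u i <= y < u (S i).
Proof.
  induction n as [|n IH]; intros H; [lra|].
  destruct (Rle_lt_dec (u n) y).
  - exists n; split; [lia | lra].
  - destruct IH as (i & Hi & Hu); [lra|]; exists i; split; [lia | exact Hu].
Qed.

(** * Lifts in standard dyadic form *)

(** The parameter [t] is the rescaled position in a dyadic interval. Both endpoints are included, so
    the formulas on adjacent intervals agree where these meet, which encodes continuity. *)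
Definition affine_on_cone (F : R -> R) m k p K : Prop :=
  forall t, 0 <= t <= 1 -> F ((IZR m + t) / 2 ^ k) = (IZR p + t) / 2 ^ K.

(** The image depths are bounded uniformly over all integers [m]. For composition, the lower bound
    makes images fine enough for the second map and the upper bound leaves finitely many depths. *)
Definition std (N a b : nat) (F : R -> R) : Prop :=
  forall m, exists p K, (a <= K <= b)%nat /\ affine_on_cone F m N p K.

Definition degree_one (F : R -> R) : Prop := forall x, F (x + 1) = F x + 1.

Definition PL (F : R -> R) : Prop :=
  degree_one F /\ exists N b, std N 0 b F.

Lemma degree_one_IZR F : degree_one F -> forall z x, F (x + IZR z) = F x + IZR z.
Proof.
  intros H.
  assert (Hn : forall n x, F (x + INR n) = F x + INR n).
  { induction n as [|n IH]; intros x; [simpl; rewrite !Rplus_0_r; reflexivity|].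
    rewrite S_INR, <- Rplus_assoc, H, IH; lra. }
  intros z x; destruct (Z_le_gt_dec 0 z).
  - rewrite <- (Z2Nat.id z), <- INR_IZR_INZ by lia; apply Hn.
  - replace (F x) with (F ((x + IZR z) + INR (Z.to_nat (- z)))).
    + rewrite Hn, INR_IZR_INZ, Z2Nat.id, opp_IZR by lia; lra.
    + f_equal; rewrite INR_IZR_INZ, Z2Nat.id, opp_IZR by lia; lra.
Qed.

Lemma std_succ N a b F : std N a b F -> std (S N) (S a) (S b) F.
Proof.
  intros H m.
  pose proof (Z.div_mod m 2 ltac:(lia)) as Hm.
  pose proof (Z.mod_pos_bound m 2 ltac:(lia)) as Hr.
  set (q := (m / 2)%Z) in *; set (r := (m mod 2)%Z) in *.
  destruct (H q) as (p & K & HK & Haff).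
  exists (2 * p + r)%Z, (S K); split; [lia|]; intros t Ht.
  assert (0 <= IZR r <= 1) by (split; apply IZR_le; lia).
  replace ((IZR m + t) / 2 ^ S N) with ((IZR q + (IZR r + t) / 2) / 2 ^ N).
  - rewrite Haff by lra; rewrite plus_IZR, mult_IZR; simpl; field; auto.
  - rewrite Hm, plus_IZR, mult_IZR; simpl; field; auto.
Qed.

Lemma std_add j N a b F : std N a b F -> std (j + N) (j + a) (j + b) F.
Proof. intros H; induction j; simpl; auto using std_succ. Qed.

Lemma std_at x N : exists m t, 0 <= t < 1 /\ x = (IZR m + t) / 2 ^ N.
Proof.
  destruct (floor_exists (x * 2 ^ N)) as [m Hm].
  exists m, (x * 2 ^ N - IZR m); split; [lra | field; auto].
Qed.

Lemma T_lift_PL F : T_lift F -> PL F.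
Proof.
  intros (H1 & Hdy & n & a & k & b & Ha0 & Han & Hda & Hinc & Haff).
  split; [exact H1|].
  set (P := fun i N => (exists z, a i = IZR z / 2 ^ N) /\
    (exists z, a (S i) = IZR z / 2 ^ N) /\
    exists K, powerRZ 2 (k i) = 2 ^ N / 2 ^ K /\ exists z, b i = IZR z / 2 ^ K).
  destruct (eventually_uniform P n) as [N HN].
  { intros i Hi.
    (* The constant is [F (a i)] minus the slope times [a i], and [F] preserves dyadics. *)
    assert (Hb : dyadic (b i)).
    { assert (Hbi : b i = F (a i) + - (powerRZ 2 (k i) * a i)).
      { rewrite (Haff i Hi) by (pose proof (Hinc i Hi); lra); lra. }
      rewrite Hbi; apply dyadic_plus; [apply (Hdy (a i)), Hda; lia|].
      apply dyadic_opp, dyadic_mult; [|apply Hda; lia].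
      destruct (Z_le_gt_dec 0 (k i)).
      - rewrite <- (Z2Nat.id (k i)), <- pow_powerRZ by lia; apply dyadic_pow2.
      - replace (k i) with (Z.of_nat 0 - Z.of_nat (Z.to_nat (- k i)))%Z by lia.
        rewrite powerRZ_2_quotient; apply dyadic_div_pow2, dyadic_pow2. }
    destruct (dyadic_eventually _ Hb) as [k1 E1].
    destruct (dyadic_eventually _ (Hda i ltac:(lia))) as [k2 E2].
    destruct (dyadic_eventually _ (Hda (S i) ltac:(lia))) as [k3 E3].
    (* The last summand keeps the image depth [K = N - k i] at least [k1], so that [b i] has
       denominator [2 ^ K]. *)
    exists (k1 + k2 + k3 + Z.to_nat (k i))%nat; intros N HN.
    split; [apply E2; lia|]; split; [apply E3; lia|].
    exists (Z.to_nat (Z.of_nat N - k i)); split; [|apply E1; lia].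
    rewrite <- powerRZ_2_quotient; f_equal; lia. }
  specialize (HN N (le_n N)).
  set (Q := fun i B => forall m, (0 <= m < 2 ^ Z.of_nat N)%Z ->
    a i <= IZR m / 2 ^ N < a (S i) ->
    exists p K, (0 <= K <= B)%nat /\ affine_on_cone F m N p K).
  destruct (eventually_uniform Q n) as [B HB].
  { intros i Hi; destruct (HN i Hi) as ((z1 & E1) & (z2 & E2) & K & E3 & z3 & E4).
    exists K; intros B HB m Hm Hmi.
    exists (m + z3)%Z, K; split; [lia|]; intros t Ht.
    rewrite E2 in Hmi; destruct Hmi as [Hm1 Hm2].
    assert (Hz : (m < z2)%Z).
    { apply lt_IZR, (Rmult_lt_reg_r (/ 2 ^ N)); [|exact Hm2].
      apply Rinv_0_lt_compat; auto. }
    assert (Hz' : IZR m + 1 <= IZR z2) by (rewrite <- plus_IZR; apply IZR_le; lia).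
    rewrite (Haff i Hi).
    - rewrite E3, E4, plus_IZR; field; auto.
    - rewrite E2; split.
      + apply Rle_trans with (1 := Hm1); apply Rmult_le_compat_r; [|lra].
        left; apply Rinv_0_lt_compat; auto.
      + apply Rmult_le_compat_r; [|lra].
        left; apply Rinv_0_lt_compat; auto. }
  specialize (HB B (le_n B)).
  (* Degree one carries the result from one period to all integers [m]. *)
  exists N, B; intros m.
  pose proof (Z.div_mod m (2 ^ Z.of_nat N) ltac:(lia)) as Hm.
  pose proof (Z.mod_pos_bound m (2 ^ Z.of_nat N) ltac:(lia)) as Hr.
  set (q := (m / 2 ^ Z.of_nat N)%Z) in *; set (r := (m mod 2 ^ Z.of_nat N)%Z) in *.
  destruct (discrete_crossing a (IZR r / 2 ^ N) n) as (i & Hi & Hai).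
  { rewrite Ha0, Han; split; [apply le_div_iff | apply div_lt_iff]; auto.
    - rewrite Rmult_0_l; apply IZR_le; lia.
    - rewrite Rmult_1_l, <- IZR_pow2; apply IZR_lt; lia. }
  destruct (HB i Hi r Hr Hai) as (p & K & HK & Hp).
  exists (p + q * 2 ^ Z.of_nat K)%Z, K; split; [exact HK|]; intros t Ht.
  replace ((IZR m + t) / 2 ^ N) with ((IZR r + t) / 2 ^ N + IZR q).
  - rewrite (degree_one_IZR F H1), Hp, plus_IZR, mult_IZR, IZR_pow2 by lra.
    field; auto.
  - rewrite Hm, plus_IZR, mult_IZR, IZR_pow2; field; auto.
Qed.

(** The breakpoints are the grid points [i / 2 ^ N]. A point is dyadic exactly when its position [t]
    in its grid interval is, and [F] keeps this position. *)
Lemma PL_T_lift F : PL F -> T_lift F.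
Proof.
  intros (H1 & N & B & Hstd); split; [exact H1|]; split.
  - intros x; destruct (std_at x N) as (m & t & Ht & ->).
    destruct (Hstd m) as (p & K & _ & Hp); rewrite Hp by lra.
    assert (Hs : forall j q, dyadic ((IZR q + t) / 2 ^ j) <-> dyadic t).
    { intros j q; split; intros H.
      - replace t with ((IZR q + t) / 2 ^ j * 2 ^ j + IZR (- q))
          by (rewrite opp_IZR; field; auto).
        apply dyadic_plus, dyadic_IZR; apply dyadic_mult, dyadic_pow2; exact H.
      - apply dyadic_div_pow2, dyadic_plus, H; apply dyadic_IZR. }
    rewrite !Hs; tauto.
  - assert (Hch : forall i : nat, exists pK : Z * nat,
      affine_on_cone F (Z.of_nat i) N (fst pK) (snd pK)).
    { intros i; destruct (Hstd (Z.of_nat i)) as (p & K & _ & H).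
      exists (p, K); exact H. }
    set (c := fun i => proj1_sig (constructive_indefinite_description _ (Hch i))).
    assert (Hc : forall i, affine_on_cone F (Z.of_nat i) N (fst (c i)) (snd (c i))).
    { intros i; exact (proj2_sig (constructive_indefinite_description _ (Hch i))). }
    exists (2 ^ N)%nat, (fun i => INR i / 2 ^ N),
      (fun i => (Z.of_nat N - Z.of_nat (snd (c i)))%Z),
      (fun i => (IZR (fst (c i)) - INR i) / 2 ^ snd (c i)).
    split; [simpl; field; auto|]; split; [|split; [|split]].
    + rewrite pow_INR; change (INR 2) with 2; field; auto.
    + intros i _; rewrite INR_IZR_INZ; apply dyadic_intro.
    + intros i _; apply Rmult_lt_compat_r; [apply Rinv_0_lt_compat; auto|].
      apply lt_INR; lia.
    + intros i _ x [Hx1 Hx2].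
      apply div_le_iff in Hx1; apply le_div_iff in Hx2; auto.
      rewrite S_INR in Hx2.
      replace x with ((IZR (Z.of_nat i) + (x * 2 ^ N - INR i)) / 2 ^ N) at 1
        by (rewrite <- INR_IZR_INZ; field; auto).
      rewrite Hc by lra.
      rewrite powerRZ_2_quotient; field; auto.
Qed.

(** Refining by [M] steps puts the image intervals of [F] at depths from [M] to [M + a], where [G]
    is affine. *)
Lemma PL_comp F G : PL F -> PL G -> PL (fun x => G (F x)).
Proof.
  intros (F1 & N & a & HF) (G1 & M & b & HG); split.
  - intros x; rewrite F1, G1; reflexivity.
  - apply (std_add M) in HF.
    assert (HG' : exists b', forall K, (M <= K <= M + a)%nat -> std K 0 b' G).
    { exists (b + M + a)%nat; intros K HK m.
      destruct (std_add (K - M) _ _ _ _ HG m) as (p & L & HL & Hp).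
      replace (K - M + M)%nat with K in Hp by lia.
      exists p, L; split; [lia | exact Hp]. }
    destruct HG' as [b' HG']; exists (M + N)%nat, b'; intros m.
    destruct (HF m) as (p & K & HK & Hp).
    destruct (HG' K ltac:(lia) p) as (q & L & HL & Hq).
    exists q, L; split; [lia|]; intros t Ht; rewrite Hp, Hq by lra; reflexivity.
Qed.

Lemma PL_shift m k : PL (fun x => x + IZR m / 2 ^ k).
Proof.
  split; [intros x; lra|]; exists k, k; intros j.
  exists (j + m)%Z, k; split; [lia|]; intros t Ht.
  rewrite plus_IZR; field; auto.
Qed.

Lemma PL_ext F G : (forall x, F x = G x) -> PL F -> PL G.
Proof. intros H; apply functional_extensionality in H; subst; auto. Qed.

Lemma PL_id : PL (fun x => x).
Proof. apply (PL_ext (fun x => x + IZR 0 / 2 ^ 0)), PL_shift; intros; simpl; lra. Qed.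

(** Each grid interval is mapped increasingly and adjacent ones share an endpoint; chaining along
    grid points handles distant arguments. *)
Lemma PL_increasing F x y : PL F -> x < y -> F x < F y.
Proof.
  intros (F1 & N & b & HF) Hxy.
  assert (Hstep : forall m t u, 0 <= t -> t < u -> u <= 1 ->
    F ((IZR m + t) / 2 ^ N) < F ((IZR m + u) / 2 ^ N)).
  { intros m t u H0 Htu H1; destruct (HF m) as (p & K & _ & Hp).
    rewrite !Hp by lra; apply Rmult_lt_compat_r; [apply Rinv_0_lt_compat; auto | lra]. }
  assert (Hnode : forall n m, F (IZR m / 2 ^ N) <= F (IZR (m + Z.of_nat n) / 2 ^ N)).
  { induction n as [|n IH]; intros m; [rewrite Z.add_0_r; lra|].
    apply Rle_trans with (1 := IH m).
    pose proof (Hstep (m + Z.of_nat n)%Z 0 1 ltac:(lra) ltac:(lra) ltac:(lra)) as H.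
    rewrite Rplus_0_r, <- plus_IZR in H.
    replace (m + Z.of_nat (S n))%Z with (m + Z.of_nat n + 1)%Z by lia; lra. }
  destruct (std_at x N) as (m & t & Ht & ->), (std_at y N) as (q & u & Hu & ->).
  assert (Hlt : IZR m + t < IZR q + u).
  { apply (Rmult_lt_reg_r (/ 2 ^ N)); [apply Rinv_0_lt_compat; auto | exact Hxy]. }
  assert (Hmq : (m <= q)%Z) by (apply IZR_lt_succ; lra).
  destruct (Z.eq_dec m q) as [->|Hne]; [apply Hstep; lra|].
  pose proof (Hstep m t 1 ltac:(lra) ltac:(lra) ltac:(lra)) as S1.
  pose proof (Hnode (Z.to_nat (q - m - 1)) (m + 1)%Z) as S2.
  replace (m + 1 + Z.of_nat (Z.to_nat (q - m - 1)))%Z with q in S2 by lia.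
  rewrite <- plus_IZR in S1.
  destruct (Req_dec u 0) as [->|]; [rewrite Rplus_0_r; lra|].
  pose proof (Hstep q 0 u ltac:(lra) ltac:(lra) ltac:(lra)) as S3.
  rewrite Rplus_0_r in S3; lra.
Qed.

Lemma PL_injective F x y : PL F -> F x = F y -> x = y.
Proof.
  intros HF H; destruct (Rtotal_order x y) as [L|[E|L]]; [|exact E|];
    apply (PL_increasing _ _ _ HF) in L; lra.
Qed.

Lemma PL_surjective_cone F N b y : degree_one F -> std N 0 b F ->
  exists m p K t, (K <= b)%nat /\ 0 <= t < 1 /\ affine_on_cone F m N p K /\
    y = (IZR p + t) / 2 ^ K.
Proof.
  intros F1 HF.
  (* This [z] puts [y] between [F z] and [F (z + 1)], so some grid interval of that period is
     crossed. *)
  destruct (floor_exists (y - F 0)) as [z Hz].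
  destruct (discrete_crossing (fun i => F (IZR z + INR i / 2 ^ N)) y (2 ^ N))
    as (i & Hi & Hy).
  { rewrite pow_INR; change (INR 2) with 2; simpl.
    replace (IZR z + 0 / 2 ^ N) with (0 + IZR z) by (field; auto).
    replace (IZR z + 2 ^ N / 2 ^ N) with (0 + IZR (z + 1))
      by (rewrite plus_IZR; field; auto).
    rewrite !(degree_one_IZR F F1), plus_IZR; lra. }
  set (m := (z * 2 ^ Z.of_nat N + Z.of_nat i)%Z).
  destruct (HF m) as (p & K & HK & Hp).
  exists m, p, K, (y * 2 ^ K - IZR p).
  assert (E0 := Hp 0 ltac:(lra)); assert (E1 := Hp 1 ltac:(lra)).
  replace ((IZR m + 0) / 2 ^ N) with (IZR z + INR i / 2 ^ N) in E0
    by (unfold m; rewrite plus_IZR, mult_IZR, IZR_pow2, <- INR_IZR_INZ; field; auto).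
  replace ((IZR m + 1) / 2 ^ N) with (IZR z + INR (S i) / 2 ^ N) in E1
    by (unfold m; rewrite S_INR, plus_IZR, mult_IZR, IZR_pow2, <- INR_IZR_INZ;
        field; auto).
  rewrite E0, E1 in Hy; destruct Hy as [Hy1 Hy2].
  apply div_le_iff in Hy1; apply lt_div_iff in Hy2; auto.
  repeat split; [lia | lra | lra | exact Hp | field; auto].
Qed.

(** Image depths are at most [b], so an interval of depth [b] lies inside the image of a single grid
    interval, where the inverse is affine. *)
Lemma PL_inverse F : PL F ->
  exists G, PL G /\ (forall y, F (G y) = y) /\ (forall x, G (F x) = x).
Proof.
  intros HPL; assert (HPL' := HPL); destruct HPL' as (F1 & N & b & HF).
  assert (Hsurj : forall y, exists x, F x = y).
  { intros y; destruct (PL_surjective_cone F N b y F1 HF)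
      as (m & p & K & t & _ & Ht & Hp & ->).
    exists ((IZR m + t) / 2 ^ N); apply Hp; lra. }
  set (G := fun y => proj1_sig (constructive_indefinite_description _ (Hsurj y))).
  assert (FG : forall y, F (G y) = y)
    by (intros y; exact (proj2_sig (constructive_indefinite_description _ (Hsurj y)))).
  exists G; split; [|split]; [|exact FG|intros x; apply (PL_injective F); auto].
  split.
  - intros y; apply (PL_injective F); auto; rewrite F1, !FG; reflexivity.
  - exists b, (N + b)%nat; intros q.
    destruct (PL_surjective_cone F N b (IZR q / 2 ^ b) F1 HF)
      as (m & p & K & t & HK & Ht & Hp & Hq).
    (* [j] counts the halvings from the image interval down to depth [b]; [d] below is the position
       of the given interval among the [2 ^ j] parts. *)
    set (j := (b - K)%nat).
    assert (Hb : 2 ^ b = 2 ^ K * 2 ^ j)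
      by (rewrite <- pow_add; f_equal; unfold j; lia).
    set (d := (q - p * 2 ^ Z.of_nat j)%Z).
    assert (Hd : IZR d = t * 2 ^ j).
    { unfold d; rewrite minus_IZR, mult_IZR, IZR_pow2.
      replace (IZR q) with (IZR q / 2 ^ b * 2 ^ b) by (field; auto).
      rewrite Hq, Hb; field; auto. }
    assert (Hd0 : 0 <= IZR d) by (rewrite Hd; apply Rmult_le_pos; [lra | left; auto]).
    assert (Hd1 : IZR d + 1 <= 2 ^ j).
    { rewrite <- IZR_pow2, <- plus_IZR; apply IZR_le.
      assert (d < 2 ^ Z.of_nat j)%Z; [|lia].
      apply lt_IZR; rewrite Hd, IZR_pow2.
      rewrite <- (Rmult_1_l (2 ^ j)) at 2; apply Rmult_lt_compat_r; auto; lra. }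
    exists (m * 2 ^ Z.of_nat j + d)%Z, (N + j)%nat; split; [lia|]; intros u Hu.
    apply (PL_injective F); auto; rewrite FG.
    rewrite plus_IZR, mult_IZR, IZR_pow2, pow_add.
    replace ((IZR m * 2 ^ j + IZR d + u) / (2 ^ N * 2 ^ j))
      with ((IZR m + (IZR d + u) / 2 ^ j) / 2 ^ N) by (field; auto).
    rewrite Hp.
    + rewrite Hb; unfold d; rewrite minus_IZR, mult_IZR, IZR_pow2; field; auto.
    + split; [apply le_div_iff | apply div_le_iff]; auto; lra.
Qed.

(** * Thompson's group as a group of circle maps *)

Definition val (x : S1) : R := proj1_sig x.

Lemma val_bounds x : 0 <= val x < 1.
Proof. exact (proj2_sig x). Qed.

Lemma val_inj x y : val x = val y -> x = y.
Proof.
  destruct x as [x hx], y as [y hy]; unfold val; simpl; intros ->.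
  f_equal; apply proof_irrelevance.
Qed.

Definition circ (F : R -> R) : S1 -> S1 :=
  fun x => exist _ (frac (F (val x))) (frac_bounds _).

Definition zeroS : S1 := exist _ 0 (conj (Rle_refl 0) Rlt_0_1).

Lemma ThompsonT_iff h : ThompsonT h <-> exists F, PL F /\ h = circ F.
Proof.
  split.
  - intros (F & HF & Hh); exists F; split; [apply T_lift_PL, HF|].
    apply functional_extensionality; intros x; apply val_inj, Hh.
  - intros (F & HF & ->); exists F; split; [apply PL_T_lift, HF | reflexivity].
Qed.

Lemma ThompsonT_circ F : PL F -> ThompsonT (circ F).
Proof. intros HF; apply ThompsonT_iff; exists F; auto. Qed.

Lemma frac_degree_one F y : degree_one F -> frac (F (frac y)) = frac (F y).
Proof.
  intros HF; destruct (frac_spec y) as (z & Hz & _).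
  destruct (frac_spec (F (frac y))) as (u & Hu & Hb).
  symmetry; apply (frac_unique (u + z)); [exact Hb|].
  replace (F y) with (F (frac y + IZR z)) by (f_equal; lra).
  rewrite (degree_one_IZR F HF), plus_IZR; lra.
Qed.

Lemma circ_comp F G : degree_one F ->
  (fun x => circ F (circ G x)) = circ (fun x => F (G x)).
Proof.
  intros HF; apply functional_extensionality; intros x; apply val_inj.
  unfold circ, val; simpl; apply frac_degree_one, HF.
Qed.

Lemma circ_id : circ (fun x => x) = (fun x => x).
Proof.
  apply functional_extensionality; intros x; apply val_inj.
  unfold circ, val at 1; simpl; apply frac_id, val_bounds.
Qed.

Lemma ThompsonT_id : ThompsonT (fun x => x).
Proof. rewrite <- circ_id; apply ThompsonT_circ, PL_id. Qed.

Lemma ThompsonT_comp f g :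
  ThompsonT f -> ThompsonT g -> ThompsonT (fun x => f (g x)).
Proof.
  rewrite !ThompsonT_iff; intros (F & HF & ->) (G & HG & ->).
  exists (fun x => F (G x)); split; [apply PL_comp; auto|].
  apply circ_comp, HF.
Qed.

Lemma ThompsonT_inverse f : ThompsonT f ->
  exists f', ThompsonT f' /\ forall x, f (f' x) = x /\ f' (f x) = x.
Proof.
  intros Hf; apply ThompsonT_iff in Hf; destruct Hf as (F & HF & ->).
  destruct (PL_inverse F HF) as (G & HG & FG & GF).
  exists (circ G); split; [apply ThompsonT_circ, HG|]; intros x; split.
  - change ((fun x => circ F (circ G x)) x = x).
    rewrite circ_comp by apply HF.
    rewrite (functional_extensionality _ (fun x => x) FG), circ_id; reflexivity.
  - change ((fun x => circ G (circ F x)) x = x).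
    rewrite circ_comp by apply HG.
    rewrite (functional_extensionality _ (fun x => x) GF), circ_id; reflexivity.
Qed.

Lemma ThompsonT_injective f x y : ThompsonT f -> f x = f y -> x = y.
Proof.
  intros Hf H; destruct (ThompsonT_inverse f Hf) as (f' & _ & Hf').
  rewrite <- (proj2 (Hf' x)), H; apply Hf'.
Qed.

Lemma ThompsonT_iter f n : ThompsonT f -> ThompsonT (fun x => Nat.iter n f x).
Proof.
  intros Hf; induction n as [|n IH]; simpl; [apply ThompsonT_id|].
  apply (ThompsonT_comp f (fun x => Nat.iter n f x)); auto.
Qed.

Lemma iter_injective f n x y :
  ThompsonT f -> Nat.iter n f x = Nat.iter n f y -> x = y.
Proof. intros Hf; apply (ThompsonT_injective _ x y (ThompsonT_iter f n Hf)). Qed.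

(** * Cones *)

Definition cone m k (x : S1) : Prop := IZR m <= val x * 2 ^ k < IZR m + 1.

(** Both sides are positions rescaled to [[0, 1)]. For [m] outside [[0, 2 ^ k)] the cone is empty
    and the condition vacuous. *)
Definition maps_cone (h : S1 -> S1) m k p K : Prop :=
  forall x, cone m k x -> val (h x) * 2 ^ K - IZR p = val x * 2 ^ k - IZR m.

Lemma cone_unique m p k x : cone m k x -> cone p k x -> m = p.
Proof. intros H1 H2; eapply floor_unique; eauto. Qed.

Lemma cone_image h m k p K x : maps_cone h m k p K -> cone m k x -> cone p K (h x).
Proof. intros Hh Hx; specialize (Hh x Hx); unfold cone in *; lra. Qed.

Lemma cone_exists k x : exists m, cone m k x.
Proof. apply floor_exists. Qed.

Lemma maps_cone_comp f g m k p K q L :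
  maps_cone f m k p K -> maps_cone g p K q L ->
  maps_cone (fun x => g (f x)) m k q L.
Proof.
  intros Hf Hg x Hx; rewrite <- (Hf x Hx); apply Hg.
  apply (cone_image f m k); auto.
Qed.

Lemma cone_shrink p j k : exists m, forall x, cone p (j + k) x -> cone m k x.
Proof.
  exists (p / 2 ^ Z.of_nat j)%Z; intros x; unfold cone; rewrite pow_add.
  pose proof (Z.div_mod p (2 ^ Z.of_nat j) ltac:(lia)) as Hp.
  pose proof (Z.mod_pos_bound p (2 ^ Z.of_nat j) ltac:(lia)) as Hr.
  set (q := (p / 2 ^ Z.of_nat j)%Z) in *; set (r := (p mod 2 ^ Z.of_nat j)%Z) in *.
  assert (Hr0 : 0 <= IZR r) by (apply IZR_le; lia).
  assert (Hr1 : IZR r + 1 <= 2 ^ j)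
    by (rewrite <- IZR_pow2, <- plus_IZR; apply IZR_le; lia).
  rewrite Hp, plus_IZR, mult_IZR, IZR_pow2; intros [H1 H2].
  split; apply Rnot_lt_le || apply Rnot_le_lt; intros H.
  - apply (Rmult_lt_compat_l (2 ^ j)) in H; auto; lra.
  - apply (Rmult_le_compat_l (2 ^ j)) in H; [lra | left; auto].
Qed.

(** The index of a coarse cone is a quotient of the fine index by a power of two, so dyadic
    intervals that meet are nested. *)
Lemma cone_nested m k p K x : (k <= K)%nat -> cone m k x -> cone p K x ->
  forall y, cone p K y -> cone m k y.
Proof.
  intros Hk Hx1 Hx2 y Hy.
  destruct (cone_shrink p (K - k) k) as [q Hq].
  replace (K - k + k)%nat with K in Hq by lia.
  rewrite (cone_unique m q k x); auto.
Qed.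

Lemma ThompsonT_cones h : ThompsonT h -> exists N, forall k m, (N <= k)%nat ->
  exists p K, maps_cone h m k p K.
Proof.
  intros Hh; apply ThompsonT_iff in Hh; destruct Hh as (F & (F1 & N & b & HF) & ->).
  exists N; intros k m Hk.
  destruct (std_add (k - N) _ _ _ _ HF m) as (p & K & _ & Hp).
  replace (k - N + N)%nat with k in Hp by lia.
  (* The image under the lift does not straddle an integer, so [frac] only reduces its index modulo
     [2 ^ K]. *)
  exists (p mod 2 ^ Z.of_nat K)%Z, K; intros x Hx.
  pose proof (Z.div_mod p (2 ^ Z.of_nat K) ltac:(lia)) as Hd.
  pose proof (Z.mod_pos_bound p (2 ^ Z.of_nat K) ltac:(lia)) as Hr.
  set (q := (p / 2 ^ Z.of_nat K)%Z) in *; set (r := (p mod 2 ^ Z.of_nat K)%Z) in *.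
  assert (Hr0 : 0 <= IZR r) by (apply IZR_le; lia).
  assert (Hr1 : IZR r + 1 <= 2 ^ K)
    by (rewrite <- IZR_pow2, <- plus_IZR; apply IZR_le; lia).
  unfold cone in Hx; set (t := val x * 2 ^ k - IZR m) in *.
  replace (val (circ F x)) with ((IZR r + t) / 2 ^ K); [field; auto|].
  unfold circ, val at 1; simpl; symmetry; apply (frac_unique q).
  - split; [apply le_div_iff | apply div_lt_iff]; auto; unfold t; lra.
  - replace (val x) with ((IZR m + t) / 2 ^ k) by (unfold t; field; auto).
    rewrite Hp by (unfold t; lra).
    rewrite Hd, plus_IZR, mult_IZR, IZR_pow2; field; auto.
Qed.

(** * Wandering cones *)

(** Only nonnegative powers are tested; [wandering_cyclic] treats the others. The identity
    alternative accommodates finite order. *)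
Definition wandering (s : S1 -> S1) m k : Prop :=
  forall n, (forall x, Nat.iter n s x = x) \/
    forall x, cone m k x -> ~ cone m k (Nat.iter n s x).

(** An injective sequence takes each of the finitely many values at most once. *)
Lemma sequence_leaves_finite_set (u : nat -> R) (a : nat -> R) L :
  (forall i j, (i < j)%nat -> u i <> u j) ->
  exists n0, forall n, (n0 <= n)%nat -> forall j, (j < L)%nat -> u n <> a j.
Proof.
  intros Hu; induction L as [|L (n0 & IH)]; [exists 0%nat; lia|].
  destruct (classic (exists n, u n = a L)) as [[n1 H1]|H1].
  - exists (n0 + S n1)%nat; intros n Hn j Hj.
    destruct (Nat.eq_dec j L) as [->|]; [|apply IH; lia].
    rewrite <- H1; apply not_eq_sym, Hu; lia.
  - exists n0; intros n Hn j Hj.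
    destruct (Nat.eq_dec j L) as [->|]; [|apply IH; lia].
    intros E; apply H1; exists n; exact E.
Qed.

Lemma exists_minimal (P : nat -> Prop) n :
  P n -> exists k, P k /\ forall j, P j -> (k <= j)%nat.
Proof.
  induction n as [n IH] using (well_founded_induction lt_wf); intros Hn.
  destruct (classic (exists j, (j < n)%nat /\ P j)) as [(j & Hj & Pj)|H].
  - exact (IH j Hj Pj).
  - exists n; split; [exact Hn|]; intros j Pj.
    apply Nat.nlt_ge; intros Hj; apply H; exists j; auto.
Qed.

Lemma cone_corner x m k : val x = IZR m / 2 ^ k -> cone m k x /\ (0 <= m < 2 ^ Z.of_nat k)%Z.
Proof.
  intros Hx; pose proof (val_bounds x) as [H0 H1].
  assert (E : val x * 2 ^ k = IZR m) by (rewrite Hx; field; auto).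
  split; [unfold cone; lra|]; split.
  - apply le_IZR; rewrite <- E; apply Rmult_le_pos; [lra | left; auto].
  - apply lt_IZR; rewrite <- E, IZR_pow2.
    rewrite <- (Rmult_1_l (2 ^ k)) at 2; apply Rmult_lt_compat_r; auto.
Qed.

Lemma corner_image h x m k p K : val x = IZR m / 2 ^ k -> maps_cone h m k p K ->
  val (h x) = IZR p / 2 ^ K.
Proof.
  intros Hx Hh; specialize (Hh x (proj1 (cone_corner x m k Hx))).
  apply (Rmult_eq_reg_r (2 ^ K)); auto.
  replace (IZR p / 2 ^ K * 2 ^ K) with (IZR p) by (field; auto).
  rewrite Hx in Hh; replace (IZR m / 2 ^ k * 2 ^ k) with (IZR m) in Hh by (field; auto).
  lra.
Qed.

(* The corners are distinct dyadics, so they eventually leave the finite grid of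
   mesh [2 ^ - N]; from then on a cone at such a corner is finer than the grid,
   and so are all its images. *)
Lemma infinite_orbit_cones s d : ThompsonT s -> dyadic (val d) ->
  (forall n, (0 < n)%nat -> Nat.iter n s d <> d) ->
  exists x, dyadic (val x) /\
    (forall i j, (i < j)%nat -> Nat.iter i s x <> Nat.iter j s x) /\
    forall i m k, val (Nat.iter i s x) = IZR m / 2 ^ k ->
      forall n, exists p K, maps_cone (fun y => Nat.iter n s y) m k p K.
Proof.
  intros Hs Hd Hinf.
  destruct (ThompsonT_cones s Hs) as [N HN].
  assert (Hdist : forall i j, (i < j)%nat -> Nat.iter i s d <> Nat.iter j s d).
  { intros i j Hij E; apply (Hinf (j - i)%nat); [lia|].
    apply (iter_injective s i); auto.
    rewrite <- Nat.iter_add; replace (i + (j - i))%nat with j by lia; auto. }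
  destruct (sequence_leaves_finite_set (fun n => val (Nat.iter n s d))
    (fun j => INR j / 2 ^ N) (2 ^ N)) as [n0 Hn0].
  { intros i j Hij E; apply (Hdist i j Hij), val_inj, E. }
  set (x := Nat.iter n0 s d).
  (* A corner of depth at most [N] would be one of the grid points that the orbit has left. *)
  assert (Hfine : forall n p K, val (Nat.iter n s x) = IZR p / 2 ^ K -> (N < K)%nat).
  { intros n p K E; apply Nat.nle_gt; intros HK.
    assert (E' : val (Nat.iter n s x) = IZR (p * 2 ^ Z.of_nat (N - K)) / 2 ^ N).
    { rewrite E, mult_IZR, IZR_pow2.
      replace N with (K + (N - K))%nat at 2 by lia; rewrite pow_add; field; auto. }
    destruct (cone_corner _ _ _ E') as [_ Hr].
    unfold x in E'; rewrite <- Nat.iter_add in E'.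
    apply (Hn0 (n + n0)%nat ltac:(lia) (Z.to_nat (p * 2 ^ Z.of_nat (N - K)))).
    - apply Nat2Z.inj_lt; rewrite Z2Nat.id, Nat2Z.inj_pow; lia.
    - cbv beta; rewrite E', INR_IZR_INZ, Z2Nat.id by lia; reflexivity. }
  exists x; split; [|split].
  - unfold x; clear Hn0 x Hfine; induction n0 as [|n IH]; [exact Hd|]; simpl.
    destruct Hs as (F & (_ & HF & _) & Hh).
    unfold val; rewrite Hh; fold (val (Nat.iter n s d)).
    destruct (frac_spec (F (val (Nat.iter n s d)))) as (z & Hz & _).
    replace (frac (F (val (Nat.iter n s d))))
      with (F (val (Nat.iter n s d)) + IZR (- z)) by (rewrite opp_IZR; lra).
    apply dyadic_plus, dyadic_IZR; apply HF in IH; exact IH.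
  - intros i j Hij; unfold x; rewrite <- !Nat.iter_add; apply Hdist; lia.
  - intros i m k Hx; induction n as [|n (p & K & IH)].
    + exists m, k; intros y _; reflexivity.
    + pose proof (corner_image _ _ _ _ _ _ Hx IH) as Hc; cbv beta in Hc.
      rewrite <- Nat.iter_add in Hc.
      destruct (HN K p) as (q & L & Hq); [apply Hfine in Hc; lia|].
      exists q, L; apply (maps_cone_comp (fun y => Nat.iter n s y) s m k p K q L); auto.
Qed.

(* At a corner where the cone is as coarse as possible, every image cone that
   meets the cone [J] is properly inside it. If [q] is the first return, the
   half of [J] missing [s ^ q J] is wandering. *)
Lemma infinite_orbit_wandering s d : ThompsonT s -> dyadic (val d) ->
  (forall n, (0 < n)%nat -> Nat.iter n s d <> d) ->
  exists m k, (0 <= m < 2 ^ Z.of_nat k)%Z /\ wandering s m k.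
Proof.
  intros Hs Hd Hinf.
  destruct (infinite_orbit_cones s d Hs Hd Hinf) as (d' & Hdy & Hdist' & Hcones').
  clear d Hd Hinf; destruct Hdy as (m' & k' & Hd').
  destruct (exists_minimal
    (fun k => exists i m, val (Nat.iter i s d') = IZR m / 2 ^ k) k')
    as (k & (i & m & Hx) & Hmin); [exists 0%nat, m'; exact Hd'|].
  set (x := Nat.iter i s d') in *.
  assert (Hcones := Hcones' i m k Hx); clear m' k' Hd' Hcones'.
  assert (Hdist : forall n, (0 < n)%nat -> Nat.iter n s x <> x)
    by (intros n Hn; unfold x; rewrite <- Nat.iter_add; apply not_eq_sym, Hdist'; lia).
  destruct (cone_corner _ _ _ Hx) as [_ Hm].
  (* Minimality of [k] makes the image cone the smaller of two nested cones. Equal depth would force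
     [p = m] and make [x] periodic. *)
  assert (Hin : forall n p K, (0 < n)%nat ->
    maps_cone (fun y => Nat.iter n s y) m k p K ->
    (exists y, cone m k y /\ cone p K y) ->
    (k < K)%nat /\ forall y, cone p K y -> cone m k y).
  { intros n p K Hn Hp (y & Hy1 & Hy2).
    pose proof (corner_image _ _ _ _ _ _ Hx Hp) as Hc; cbv beta in Hc.
    assert (HkK : (k <= K)%nat).
    { apply Hmin; exists (n + i)%nat, p; rewrite Nat.iter_add; exact Hc. }
    split; [|intros z; apply (cone_nested m k p K y); auto].
    destruct (Nat.eq_dec k K) as [->|]; [exfalso|lia].
    rewrite (cone_unique m p K y) in Hx by auto.
    apply (Hdist n Hn), val_inj; rewrite Hc, Hx; reflexivity. }
  set (meets := fun n => (0 < n)%nat /\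
    exists y, cone m k y /\ cone m k (Nat.iter n s y)).
  destruct (classic (exists n, meets n)) as [[n0 Hn0]|Hno].
  2:{ exists m, k; split; [exact Hm|]; intros [|n]; [left; reflexivity|right].
      intros y Hy Hy'; apply Hno; exists (S n); split; [lia|]; exists y; auto. }
  destruct (exists_minimal meets n0 Hn0) as (q & (Hq & y & Hy1 & Hy2) & Hqmin).
  destruct (Hcones q) as (p & K & Hp).
  pose proof (cone_image _ _ _ _ _ _ Hp Hy1) as Hy3; cbv beta in Hy3.
  destruct (Hin q p K Hq Hp) as [HK Hsub]; [eauto|].
  (* The image cone has depth at least [k + 1], so it cannot meet both halves. *)
  assert (Hhalf : exists r, (2 * m <= r <= 2 * m + 1)%Z /\
    (forall z, cone r (S k) z -> cone m k z) /\
    forall z, cone r (S k) z -> ~ cone p K z).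
  { assert (Hup : forall r z, (2 * m <= r <= 2 * m + 1)%Z ->
      cone r (S k) z -> cone m k z).
    { intros r z Hr; unfold cone; simpl.
      assert (2 * IZR m <= IZR r) by (rewrite <- mult_IZR; apply IZR_le; lia).
      assert (IZR r <= 2 * IZR m + 1)
        by (rewrite <- mult_IZR, <- plus_IZR; apply IZR_le; lia).
      lra. }
    assert (Hmiss : forall r r' z, cone r (S k) z -> cone p K z ->
      r <> r' -> forall z', cone r' (S k) z' -> ~ cone p K z').
    { intros r r' z Hz Hz' Hr z' H1 H2; apply Hr.
      apply (cone_unique r r' (S k) z'); auto.
      apply (cone_nested r (S k) p K z); auto. }
    destruct (classic (exists z, cone (2 * m) (S k) z /\ cone p K z))
      as [(z & Hz & Hz')|Hnz].
    - exists (2 * m + 1)%Z; split; [lia|]; split.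
      + intros; eapply Hup; eauto; lia.
      + apply (Hmiss (2 * m)%Z _ z); auto; lia.
    - exists (2 * m)%Z; split; [lia|]; split.
      + intros; eapply Hup; eauto; lia.
      + intros z H1 H2; apply Hnz; eauto. }
  destruct Hhalf as (r & Hr & Hrm & Hrp).
  (* No return happens before time [q], and a later one is a return, in less time, of the point
     already brought back at time [q]. So all returns land in the first image. *)
  assert (Hret : forall n z, (0 < n)%nat -> cone m k z ->
    cone p K (Nat.iter n s z) \/ ~ cone m k (Nat.iter n s z)).
  { induction n as [n IH] using (well_founded_induction lt_wf); intros z Hn Hz.
    destruct (lt_eq_lt_dec n q) as [[L|E]|L].
    - right; intros Hz'.
      assert (q <= n)%nat; [|lia]. apply Hqmin; split; eauto.
    - left; subst n; exact (cone_image _ _ _ _ _ _ Hp Hz).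
    - replace n with ((n - q) + q)%nat by lia; rewrite Nat.iter_add.
      apply IH; [lia | lia|].
      apply Hsub; exact (cone_image _ _ _ _ _ _ Hp Hz). }
  exists r, (S k); split.
  { rewrite Nat2Z.inj_succ, Z.pow_succ_r; lia. }
  intros [|n]; [left; reflexivity|right]; intros z Hz Hz'.
  destruct (Hret (S n) z) as [H|H]; [lia | auto | |].
  - exact (Hrp _ Hz' H).
  - exact (H (Hrm _ Hz')).
Qed.

(** * Elements whose dyadic points are all periodic *)

Lemma ThompsonT_fix0_increasing s x y : ThompsonT s -> s zeroS = zeroS ->
  val x < val y -> val (s x) < val (s y).
Proof.
  intros Hs H0 Hxy; apply ThompsonT_iff in Hs; destruct Hs as (F & HF & ->).
  destruct (frac_spec (F 0)) as (z & Hz & _).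
  assert (E0 : frac (F 0) = 0) by (exact (f_equal val H0)).
  (* [F 0] is the integer [z], so [F - z] maps [[0, 1)] into itself and [frac] only subtracts
     [z]. *)
  assert (Hv : forall u, val (circ F u) = F (val u) - IZR z).
  { intros u; pose proof (val_bounds u) as [Hu0 Hu1].
    unfold circ, val at 1; simpl; apply (frac_unique z); [|lra].
    pose proof (PL_increasing F _ _ HF Hu1) as H1.
    replace (F 1) with (F 0 + 1) in H1 by (rewrite <- (proj1 HF); f_equal; lra).
    destruct Hu0 as [Hu0|<-]; [apply (PL_increasing F _ _ HF) in Hu0|]; lra. }
  rewrite !Hv; apply (PL_increasing F _ _ HF) in Hxy; lra.
Qed.

(** The power [s ^ q] fixes [0], so it is increasing on [[0, 1)], and periodic points of an
    increasing map are fixed. All dyadics are thus fixed, and density gives the rest. *)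
Lemma dyadic_periodic_torsion s q : ThompsonT s ->
  (forall d, dyadic (val d) -> exists n, (0 < n)%nat /\ Nat.iter n s d = d) ->
  Nat.iter q s zeroS = zeroS -> forall x, Nat.iter q s x = x.
Proof.
  intros Hs Hper H0.
  set (f := fun x => Nat.iter q s x).
  assert (Hinc : forall x y, val x < val y -> val (f x) < val (f y)).
  { intros x y; apply ThompsonT_fix0_increasing; auto; apply ThompsonT_iter; auto. }
  assert (Hiter : forall n x, Nat.iter n f x = Nat.iter (n * q) s x).
  { induction n as [|n IH]; intros x; simpl; [reflexivity|].
    rewrite Nat.iter_add, IH; reflexivity. }
  assert (Hfd : forall d, dyadic (val d) -> f d = d).
  { intros d Hd; destruct (Hper d Hd) as (n & Hn & E).
    assert (Ef : Nat.iter n f d = d).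
    { rewrite Hiter, Nat.mul_comm; clear -E.
      induction q as [|q IH]; simpl; [reflexivity|].
      rewrite Nat.iter_add, IH; exact E. }
    destruct n as [|n]; [lia|]; rewrite Nat.iter_succ_r in Ef.
    apply val_inj; destruct (Rtotal_order (val (f d)) (val d)) as [H|[H|H]]; auto.
    - assert (Hi : forall j, val (Nat.iter j f (f d)) < val d).
      { induction j as [|j IH]; simpl; [exact H|].
        apply Rlt_trans with (val (f d)); auto. }
      specialize (Hi n); rewrite Ef in Hi; lra.
    - assert (Hi : forall j, val d < val (Nat.iter j f (f d))).
      { induction j as [|j IH]; simpl; [exact H|].
        apply Rlt_trans with (val (f d)); auto. }
      specialize (Hi n); rewrite Ef in Hi; lra. }
  intros x; fold (f x); apply val_inj.
  assert (Hbetween : forall y z, val y < val z ->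
    exists d, dyadic (val d) /\ val y < val d < val z).
  { intros y z Hyz; destruct (dyadic_dense _ _ Hyz) as (m & k & Hmk).
    pose proof (val_bounds y); pose proof (val_bounds z).
    assert (Hb : 0 <= IZR m / 2 ^ k < 1) by lra.
    exists (exist (fun r => 0 <= r < 1) _ Hb); split; [apply dyadic_intro | exact Hmk]. }
  destruct (Rtotal_order (val (f x)) (val x)) as [H|[H|H]]; auto;
    destruct (Hbetween _ _ H) as (d & Hd & H1 & H2); [apply Hinc in H2 | apply Hinc in H1];
    rewrite (Hfd d Hd) in *; lra.
Qed.

Lemma finite_orbit_gap s q : (forall i, (0 < i < q)%nat -> Nat.iter i s zeroS <> zeroS) ->
  exists k, forall i, (0 < i < q)%nat -> ~ cone 0 k (Nat.iter i s zeroS).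
Proof.
  intros H.
  destruct (eventually_uniform
    (fun i k => (0 < i)%nat -> ~ cone 0 k (Nat.iter i s zeroS)) q) as [k Hk].
  - intros i Hi; destruct (Nat.eq_dec i 0) as [->|Hi0]; [exists 0%nat; lia|].
    assert (Hpos : 0 < val (Nat.iter i s zeroS)).
    { destruct (val_bounds (Nat.iter i s zeroS)) as [[L|E] _]; auto.
      exfalso; apply (H i ltac:(lia)), val_inj; rewrite <- E; reflexivity. }
    destruct (exists_inv_pow2_lt _ Hpos) as [k0 Hk0].
    exists k0; intros k Hk _ [_ Hc].
    apply div_lt_iff in Hk0; auto.
    assert (2 ^ k0 <= 2 ^ k) by (apply Rle_pow; [lra | lia]).
    assert (val (Nat.iter i s zeroS) * 2 ^ k0 <= val (Nat.iter i s zeroS) * 2 ^ k)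
      by (apply Rmult_le_compat_l; lra).
    lra.
  - exists k; intros i Hi; apply Hk; lia.
Qed.

(** With [q] the period of [0], [s ^ q] is the identity. The cone starts at [0] and avoids the rest
    of the orbit of [0]. If it contained [x] and [s ^ n x] with [0 < n < q], then [s ^ n] would
    break the cyclic order of [0], [x] and the preimage of [0]. *)
Lemma torsion_wandering s : ThompsonT s ->
  (forall d, dyadic (val d) -> exists n, (0 < n)%nat /\ Nat.iter n s d = d) ->
  exists m k, (0 <= m < 2 ^ Z.of_nat k)%Z /\ wandering s m k.
Proof.
  intros Hs Hper.
  destruct (Hper zeroS (dyadic_IZR 0)) as (n0 & Hn0).
  destruct (exists_minimal (fun n => (0 < n)%nat /\ Nat.iter n s zeroS = zeroS) n0 Hn0)
    as (q & (Hq & Hq0) & Hmin).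
  assert (Hid := dyadic_periodic_torsion s q Hs Hper Hq0).
  assert (Hne : forall i, (0 < i < q)%nat -> Nat.iter i s zeroS <> zeroS).
  { intros i Hi E; specialize (Hmin i (conj (proj1 Hi) E)); lia. }
  destruct (finite_orbit_gap s q Hne) as [k Hk].
  exists 0%Z, k; split; [lia|].
  intros n; induction n as [n IH] using (well_founded_induction lt_wf).
  destruct (Nat.eq_dec n 0) as [->|Hn]; [left; reflexivity|].
  destruct (le_lt_dec q n) as [Hqn|Hqn].
  { replace n with ((n - q) + q)%nat by lia.
    destruct (IH (n - q)%nat ltac:(lia)) as [H|H]; [left|right]; intros x;
      rewrite Nat.iter_add, Hid; auto. }
  right; intros x [_ Hx] [_ Hy]; rewrite Rplus_0_l in Hx, Hy.
  (* The preimage of [0] under [s ^ n], written with a positive exponent. *)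
  set (z := Nat.iter (q - n) s zeroS).
  assert (Hz : Nat.iter n s z = zeroS).
  { unfold z; rewrite <- Nat.iter_add; replace (n + (q - n))%nat with q by lia; auto. }
  assert (Hout : forall i, (0 < i < q)%nat -> 1 <= val (Nat.iter i s zeroS) * 2 ^ k).
  { intros i Hi; apply Rnot_lt_le; intros L; apply (Hk i Hi); split; [|lra].
    apply Rmult_le_pos; [apply val_bounds | left; auto]. }
  assert (Hmon : forall u v, u * 2 ^ k < 1 -> 1 <= v * 2 ^ k -> u < v).
  { intros u v Hu Hv; apply (Rmult_lt_reg_r (2 ^ k)); auto; lra. }
  assert (Hxz : val x < val z) by (apply Hmon; auto; apply Hout; lia).
  assert (Hy0 : val (Nat.iter n s x) < val (Nat.iter n s zeroS))
    by (apply Hmon; auto; apply Hout; lia).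
  assert (Hsn := ThompsonT_iter s n Hs); apply ThompsonT_iff in Hsn.
  destruct Hsn as (G & HG & EG).
  assert (Ev : forall u, exists a, G (val u) = IZR a + val (Nat.iter n s u)).
  { intros u; change (Nat.iter n s u) with ((fun x => Nat.iter n s x) u).
    rewrite EG; destruct (frac_spec (G (val u))) as (a & Ha & _); exists a; exact Ha. }
  (* These are the integer parts of the lift at [x], [0] and [z]. Monotonicity along
     [0 <= x < z < 1] forces [b < a < c < b + 2]. *)
  destruct (Ev x) as [a Ha], (Ev zeroS) as [b Hb], (Ev z) as [c Hc].
  rewrite Hz in Hc; change (val zeroS) with 0 in *.
  pose proof (val_bounds x) as [Hx0 _]; pose proof (val_bounds z) as [_ Hz1].
  pose proof (val_bounds (Nat.iter n s x)); pose proof (val_bounds (Nat.iter n s zeroS)).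
  apply (PL_increasing G _ _ HG) in Hxz; apply (PL_increasing G _ _ HG) in Hz1.
  replace (G 1) with (G 0 + 1) in Hz1 by (rewrite <- (proj1 HG); f_equal; lra).
  assert (H0x : G 0 <= G (val x))
    by (destruct Hx0 as [L|<-]; [left; apply (PL_increasing G _ _ HG), L | lra]).
  assert (b < a)%Z by (apply lt_IZR; lra).
  assert (a < c)%Z by (apply lt_IZR; lra).
  assert (c < b + 2)%Z by (apply lt_IZR; rewrite plus_IZR; lra).
  lia.
Qed.

Lemma ThompsonT_wandering s : ThompsonT s ->
  exists m k, (0 <= m < 2 ^ Z.of_nat k)%Z /\ wandering s m k.
Proof.
  intros Hs.
  destruct (classic (exists d, dyadic (val d) /\
    forall n, (0 < n)%nat -> Nat.iter n s d <> d)) as [(d & Hd & Hinf)|H].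
  - exact (infinite_orbit_wandering s d Hs Hd Hinf).
  - apply torsion_wandering; [exact Hs|]; intros d Hd; apply NNPP; intros Hn.
    apply H; exists d; split; [exact Hd|]; intros n Hpos E; apply Hn; eauto.
Qed.

(** * Cyclic subgroups *)

(* Phrased with nonnegative exponents only: [v = s ^ (b - a)]. *)
Definition cyclic (s v : S1 -> S1) : Prop :=
  exists a b, forall x, Nat.iter a s (v x) = Nat.iter b s x.

Lemma cyclic_gen s : cyclic s s.
Proof. exists 0%nat, 1%nat; reflexivity. Qed.

Lemma cyclic_comp s v w : cyclic s v -> cyclic s w -> cyclic s (fun x => v (w x)).
Proof.
  intros (a & b & Hv) (c & d & Hw); exists (c + a)%nat, (b + d)%nat; intros x.
  rewrite Nat.iter_add, Hv, <- Nat.iter_add, Nat.add_comm, Nat.iter_add, Hw.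
  symmetry; apply Nat.iter_add.
Qed.

Lemma cyclic_inverse s v v' : cyclic s v -> (forall x, v (v' x) = x) -> cyclic s v'.
Proof.
  intros (a & b & Hv) H; exists b, a; intros x; rewrite <- Hv, H; reflexivity.
Qed.

(** If a negative power brings a point of the cone back, the opposite positive power returns the
    image to that point. *)
Lemma wandering_cyclic s m k v : ThompsonT s -> wandering s m k -> cyclic s v ->
  (forall x, v x = x) \/ forall x, cone m k x -> ~ cone m k (v x).
Proof.
  intros Hs Hw (a & b & Hv); destruct (le_lt_dec a b) as [Hab|Hab].
  - assert (E : forall x, v x = Nat.iter (b - a) s x).
    { intros x; apply (iter_injective s a); auto.
      rewrite Hv, <- Nat.iter_add; f_equal; lia. }
    destruct (Hw (b - a)%nat) as [H|H]; [left|right]; intros x; rewrite E; auto.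
  - assert (E : forall x, Nat.iter (a - b) s (v x) = x).
    { intros x; apply (iter_injective s b); auto.
      rewrite <- (Hv x), <- Nat.iter_add; f_equal; lia. }
    destruct (Hw (a - b)%nat) as [H|H]; [left|right]; intros x.
    + rewrite <- (E x) at 2; symmetry; apply H.
    + intros Hx Hvx; apply (H _ Hvx); rewrite E; exact Hx.
Qed.

(** * Squeezing the complement of an arc into a cone *)

(** On [[0, 1]] this is the standard generator [x_0] of Thompson's group F. As it fixes [0], it also
    serves as the element of T excluded in the end. *)
Definition squeeze (y : R) : R :=
  if Rle_dec y (1/2) then y / 2
  else if Rle_dec y (3/4) then y - 1/4 else 2 * y - 1.

Definition squeeze_lift (x : R) : R := squeeze (frac x) + (x - frac x).

Ltac squeeze_cases := unfold squeeze; repeat destruct Rle_dec; try lra.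

(** At [y = 1] the formula agrees with the next period since [squeeze 1 = 1]; this covers the closed
    ends of grid intervals. *)
Lemma squeeze_lift_on_unit q y :
  0 <= y <= 1 -> squeeze_lift (IZR q + y) = IZR q + squeeze y.
Proof.
  intros Hy; unfold squeeze_lift; destruct (Req_dec y 1) as [->|Hy1].
  - rewrite (frac_unique (q + 1) 0) by (rewrite ?plus_IZR; lra); squeeze_cases.
  - rewrite (frac_unique q y) by lra; lra.
Qed.

Lemma PL_squeeze_lift : PL squeeze_lift.
Proof.
  split.
  - intros x; destruct (frac_spec x) as (z & Hz & Hf).
    unfold squeeze_lift; rewrite (frac_unique (z + 1) (frac x) (x + 1)); [lra|lra|].
    rewrite plus_IZR; lra.
  - exists 2%nat, 3%nat; intros m.
    pose proof (Z.div_mod m 4 ltac:(lia)) as Hm.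
    pose proof (Z.mod_pos_bound m 4 ltac:(lia)) as Hr.
    set (q := (m / 4)%Z) in *; set (r := (m mod 4)%Z) in *.
    assert (Hm' : IZR m = 4 * IZR q + IZR r) by (rewrite Hm, plus_IZR, mult_IZR; lra).
    assert (E : forall t, 0 <= t <= 1 ->
      squeeze_lift ((IZR m + t) / 2 ^ 2) = IZR q + squeeze ((IZR r + t) / 4)).
    { intros t Ht; assert (0 <= IZR r <= 3) by (split; apply IZR_le; lia).
      rewrite <- squeeze_lift_on_unit by lra; f_equal; rewrite Hm'; field. }
    clearbody r; clear Hm Hm'.
    assert (Hr' : (r = 0 \/ r = 1 \/ r = 2 \/ r = 3)%Z) by lia.
    (* The quarters of a period go to intervals of lengths [1/8], [1/8], [1/4] and [1/2]. *)
    destruct Hr' as [->|[->|[->| ->]]];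
      [exists (8 * q)%Z, 3%nat | exists (8 * q + 1)%Z, 3%nat
      | exists (4 * q + 1)%Z, 2%nat | exists (2 * q + 1)%Z, 1%nat];
      (split; [lia|]; intros t Ht; rewrite E by lra;
       rewrite ?plus_IZR, mult_IZR; simpl; squeeze_cases).
Qed.

Definition squeezeS : S1 -> S1 := circ squeeze_lift.

Lemma val_squeezeS x : val (squeezeS x) = squeeze (val x).
Proof.
  unfold squeezeS, circ, val at 1; simpl; pose proof (val_bounds x) as Hx.
  apply (frac_unique 0); [squeeze_cases|].
  rewrite <- (squeeze_lift_on_unit 0) by lra; f_equal; lra.
Qed.

Lemma inv_pow2_succ k : 1 / 2 ^ S k = 1 / 2 ^ k / 2.
Proof. simpl; field; auto. Qed.

Lemma inv_pow2_pos k : 0 < 1 / 2 ^ k.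
Proof. apply Rdiv_lt_0_compat; auto; lra. Qed.

Lemma inv_pow2_le i j : (i <= j)%nat -> 1 / 2 ^ j <= 1 / 2 ^ i.
Proof.
  induction 1 as [|j _ IH]; [lra|].
  rewrite inv_pow2_succ; pose proof (inv_pow2_pos j); lra.
Qed.

Lemma squeeze_iter_contracts k x : val x < 1 / 2 ->
  val (Nat.iter k squeezeS x) < 1 / 2 ^ S k.
Proof.
  intros Hx; induction k as [|k IH]; [simpl; lra|].
  rewrite Nat.iter_succ, val_squeezeS, inv_pow2_succ.
  pose proof (inv_pow2_le 1 (S k) ltac:(lia)); simpl (2 ^ 1) in *.
  squeeze_cases.
Qed.

(** Above [3/4] each step doubles the distance to [1]; points of [[1/2, 3/4)] fall below [1/2] in
    one step. *)
Lemma squeeze_iter_reaches_half j x : val x < 1 - 1 / 2 ^ S j ->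
  val (Nat.iter j squeezeS x) < 1 / 2.
Proof.
  revert x; induction j as [|j IH]; intros x Hx; [simpl in *; lra|].
  rewrite Nat.iter_succ_r; apply IH; rewrite val_squeezeS.
  pose proof (inv_pow2_le 1 (S j) ltac:(lia)) as H; simpl (2 ^ 1) in H.
  rewrite inv_pow2_succ in Hx; squeeze_cases.
Qed.

(** Consecutive arcs abut and fill [[1/2, 1)]. *)
Definition arc n (x : S1) : Prop :=
  1 - 1 / 2 ^ S n <= val x < 1 - 1 / 2 ^ S (S n).

Lemma arc_disjoint i j x : i <> j -> arc i x -> ~ arc j x.
Proof.
  unfold arc; intros Hij Hi Hj.
  destruct (Nat.lt_total i j) as [L|[E|L]]; [|contradiction|].
  - pose proof (inv_pow2_le (S (S i)) (S j) ltac:(lia)); lra.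
  - pose proof (inv_pow2_le (S (S j)) (S i) ltac:(lia)); lra.
Qed.

(** Rotating by the length of the arc pushes it against [1]. Then [n + 1] squeezes bring its
    complement below [1/2], [k] more make it shorter than the cone, and a rotation by [m / 2 ^ k]
    places it. *)
Lemma arc_complement_into_cone n m k : (0 <= m < 2 ^ Z.of_nat k)%Z ->
  exists g, ThompsonT g /\ forall x, ~ arc n x -> cone m k (g x).
Proof.
  intros Hm.
  set (rot1 := circ (fun x => x + IZR 1 / 2 ^ S (S n))).
  set (rot2 := circ (fun x => x + IZR m / 2 ^ k)).
  exists (fun x => rot2 (Nat.iter (k + S n) squeezeS (rot1 x))); split.
  { apply (ThompsonT_comp rot2); [apply ThompsonT_circ, PL_shift|].
    apply (ThompsonT_comp (fun x => Nat.iter (k + S n) squeezeS x)).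
    - apply ThompsonT_iter, ThompsonT_circ, PL_squeeze_lift.
    - apply ThompsonT_circ, PL_shift. }
  intros x Hx.
  assert (H1 : val (rot1 x) < 1 - 1 / 2 ^ S (S n)).
  { pose proof (val_bounds x) as Hb.
    pose proof (inv_pow2_pos (S (S n))).
    pose proof (inv_pow2_le 1 (S n) ltac:(lia)) as H1; simpl (2 ^ 1) in H1.
    change (val (rot1 x)) with (frac (val x + 1 / 2 ^ S (S n))).
    unfold arc in Hx; rewrite (inv_pow2_succ (S n)) in *.
    destruct (Rlt_dec (val x) (1 - 1 / 2 ^ S n)).
    - rewrite frac_id; lra.
    - rewrite (frac_unique 1 (val x + 1 / 2 ^ S n / 2 - 1)); [|split|]; lra. }
  apply squeeze_iter_reaches_half in H1.
  apply (squeeze_iter_contracts k) in H1; rewrite <- Nat.iter_add in H1.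
  set (y := Nat.iter (k + S n) squeezeS (rot1 x)) in *.
  pose proof (val_bounds y) as Hy; rewrite inv_pow2_succ in H1.
  pose proof (inv_pow2_pos k).
  assert (Hym : 0 <= val y * 2 ^ k < 1).
  { split; [apply Rmult_le_pos; [lra | left; auto]|].
    apply lt_div_iff; auto; lra. }
  assert (Hm0 : 0 <= IZR m) by (apply IZR_le; lia).
  assert (Hm1 : IZR m + 1 <= 2 ^ k)
    by (rewrite <- IZR_pow2, <- plus_IZR; apply IZR_le; lia).
  assert (E : (val y + IZR m / 2 ^ k) * 2 ^ k = val y * 2 ^ k + IZR m)
    by (field; auto).
  unfold cone; change (val (rot2 y)) with (frac (val y + IZR m / 2 ^ k)).
  rewrite frac_id.
  - rewrite E; lra.
  - split.
    + apply Rplus_le_le_0_compat; [lra|]; apply le_div_iff; auto; lra.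
    + apply (Rmult_lt_reg_r (2 ^ k)); auto; rewrite E; lra.
Qed.

(** Here [g] takes the complement of the arc into a wandering cone. If the conjugate [u] kept a
    point in that complement, [v] would keep a point in the cone. *)
Lemma exists_pingpong_conjugator s n : ThompsonT s -> exists g, ThompsonT g /\
  forall u v, cyclic s v -> (forall x, g (u x) = v (g x)) ->
    u = (fun x => x) \/ forall x, ~ arc n x -> arc n (u x).
Proof.
  intros Hs; destruct (ThompsonT_wandering s Hs) as (m & k & Hm & Hw).
  destruct (arc_complement_into_cone n m k Hm) as (g & Hg & Hin).
  exists g; split; [exact Hg|]; intros u v Hv Hu.
  destruct (wandering_cyclic s m k v Hs Hw Hv) as [Hid|Hout]; [left|right].
  - apply functional_extensionality; intros x.
    apply (ThompsonT_injective g); auto; rewrite Hu, Hid; reflexivity.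
  - intros x Hx; apply NNPP; intros Hux.
    apply (Hout (g x) (Hin x Hx)); rewrite <- Hu; apply Hin, Hux.
Qed.

(** * Countability *)

(** The number [c] is read as an infinite list by iterated Cantor unpairing. *)
Fixpoint entry (c i : nat) : nat :=
  match i with
  | O => fst (of_nat c)
  | S i => entry (snd (of_nat c)) i
  end.

Lemma entry_surjective (f : nat -> nat) n :
  exists c, forall i, (i < n)%nat -> entry c i = f i.
Proof.
  revert f; induction n as [|n IH]; intros f; [exists 0%nat; lia|].
  destruct (IH (fun i => f (S i))) as [c Hc].
  exists (to_nat (f 0%nat, c)); intros [|i] Hi; cbn [entry];
    rewrite cancel_of_to; [reflexivity|].
  apply Hc; lia.
Qed.

Definition coded_int e : Z := (Z.of_nat (entry e 0) - Z.of_nat (entry e 1))%Z.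

(** Entry [0] is the depth; entry [i + 1] packs the image index of cone [i], as a difference of
    naturals, with its image depth. *)
Definition describes (c : nat) (h : S1 -> S1) : Prop :=
  forall i, (i < 2 ^ entry c 0)%nat ->
    maps_cone h (Z.of_nat i) (entry c 0)
      (coded_int (entry c (S i))) (entry (entry c (S i)) 2).

Lemma describes_exists h : ThompsonT h -> exists c, describes c h.
Proof.
  intros Hh; destruct (ThompsonT_cones h Hh) as [N HN].
  assert (He : forall i : nat, exists e,
    maps_cone h (Z.of_nat i) N (coded_int e) (entry e 2)).
  { intros i; destruct (HN N (Z.of_nat i) (le_n N)) as (p & K & Hp).
    destruct (entry_surjective (fun j => match j with
      | 0%nat => Z.to_nat p | 1%nat => Z.to_nat (- p) | _ => K end) 3) as [e He].
    exists e; unfold coded_int; rewrite !He by lia.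
    replace (Z.of_nat (Z.to_nat p) - Z.of_nat (Z.to_nat (- p)))%Z with p by lia.
    exact Hp. }
  set (e := fun i => proj1_sig (constructive_indefinite_description _ (He i))).
  assert (He' : forall i, maps_cone h (Z.of_nat i) N (coded_int (e i)) (entry (e i) 2)).
  { intros i; exact (proj2_sig (constructive_indefinite_description _ (He i))). }
  destruct (entry_surjective (fun j => match j with
    | 0%nat => N | S i => e i end) (S (2 ^ N))) as [c Hc].
  exists c; unfold describes; rewrite (Hc 0%nat) by lia.
  intros i Hi; rewrite Hc by lia; apply He'.
Qed.

Lemma describes_unique c h h' : describes c h -> describes c h' -> h = h'.
Proof.
  intros H H'; apply functional_extensionality; intros x; apply val_inj.
  destruct (cone_exists (entry c 0) x) as [m Hm].
  assert (Hr : (0 <= m < 2 ^ Z.of_nat (entry c 0))%Z).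
  { pose proof (val_bounds x) as [H0 H1]; destruct Hm as [Hm0 Hm1].
    assert (0 <= val x * 2 ^ entry c 0) by (apply Rmult_le_pos; [lra | left; auto]).
    split.
    - apply IZR_lt_succ; lra.
    - apply lt_IZR; rewrite IZR_pow2; apply Rle_lt_trans with (1 := Hm0).
      rewrite <- (Rmult_1_l (2 ^ entry c 0)) at 2; apply Rmult_lt_compat_r; auto. }
  rewrite <- (Z2Nat.id m) in Hm by lia.
  assert (Hi : (Z.to_nat m < 2 ^ entry c 0)%nat)
    by (apply Nat2Z.inj_lt; rewrite Z2Nat.id, Nat2Z.inj_pow; lia).
  specialize (H _ Hi x Hm); specialize (H' _ Hi x Hm).
  apply (Rmult_eq_reg_r (2 ^ entry (entry c (S (Z.to_nat m))) 2)); auto; lra.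
Qed.

(** * Ping-pong *)

Inductive product {X} (C : nat -> (X -> X) -> Prop) : (X -> X) -> Prop :=
| product_id : product C (fun x => x)
| product_mul i u w : C i u -> product C w -> product C (fun x => u (w x)).

(** Normal forms as in a free product; the index names the factor of the outermost letter. *)
Inductive reduced {X} (C : nat -> (X -> X) -> Prop) : nat -> (X -> X) -> Prop :=
| reduced_one i u : C i u -> u <> (fun x => x) -> reduced C i u
| reduced_mul i j u w : C i u -> u <> (fun x => x) -> j <> i -> reduced C j w ->
    reduced C i (fun x => u (w x)).

(** A letter put before a reduced word is dropped if trivial, merged with a leading letter of the
    same factor, and otherwise kept. *)
Lemma product_reduced {X} (C : nat -> (X -> X) -> Prop) u :
  (forall i u v, C i u -> C i v -> C i (fun x => u (v x))) ->
  product C u -> u = (fun x => x) \/ exists i, reduced C i u.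
Proof.
  intros C_comp; induction 1 as [|i u w Hu _ IH]; [left; reflexivity|].
  destruct (classic (u = (fun x => x))) as [->|Hne]; [exact IH|].
  destruct IH as [->|[j Hj]]; [right; exists i; apply reduced_one; auto|].
  destruct (Nat.eq_dec j i) as [->|Hji].
  2:{ right; exists i; apply (reduced_mul C i j); auto. }
  inversion Hj as [i' v Hv Hv' | i' l v w' Hv Hv' Hl Hw']; subst.
  - destruct (classic ((fun x => u (w x)) = (fun x => x))) as [E|E]; [left; exact E|].
    right; exists i; apply reduced_one; auto.
  (* A trivial merged letter cancels and leaves the reduced tail [w']. *)
  - destruct (classic ((fun x => u (v x)) = (fun x => x))) as [E|E]; right.
    + exists l; replace (fun x => u (v (w' x))) with w'; [exact Hw'|].
      apply functional_extensionality; intros x.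
      symmetry; exact (f_equal (fun f => f (w' x)) E).
    + exists i; apply (reduced_mul C i l (fun x => u (v x)) w'); auto.
Qed.

(** The innermost letter sends the point into its own set; each further letter, from another factor,
    finds it outside its set and takes it there. *)
Lemma reduced_maps {X} (C : nat -> (X -> X) -> Prop) (A : nat -> X -> Prop) i u :
  (forall i j x, i <> j -> A i x -> ~ A j x) ->
  (forall i u, C i u -> u = (fun x => x) \/ forall x, ~ A i x -> A i (u x)) ->
  reduced C i u -> forall x, (forall j, ~ A j x) -> A i (u x).
Proof.
  intros A_disjoint C_pingpong.
  induction 1 as [i u Hu Hne | i j u w Hu Hne Hji _ IH]; intros x Hx;
    destruct (C_pingpong i u Hu) as [E|Hpp]; try contradiction; apply Hpp.
  - apply Hx.
  - apply (A_disjoint j i); auto.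
Qed.

Lemma product_maps {X} (C : nat -> (X -> X) -> Prop) (A : nat -> X -> Prop) u x :
  (forall i u v, C i u -> C i v -> C i (fun x => u (v x))) ->
  (forall i j x, i <> j -> A i x -> ~ A j x) ->
  (forall i u, C i u -> u = (fun x => x) \/ forall x, ~ A i x -> A i (u x)) ->
  product C u -> (forall j, ~ A j x) -> u = (fun x => x) \/ exists i, A i (u x).
Proof.
  intros C_comp A_disjoint C_pingpong Hu Hx.
  destruct (product_reduced C u C_comp Hu) as [E|[i Hi]]; [left; exact E|].
  right; exists i; apply (reduced_maps C A); auto.
Qed.

Lemma product_comp {X} (C : nat -> (X -> X) -> Prop) u w :
  product C u -> product C w -> product C (fun x => u (w x)).
Proof.
  intros Hu Hw; induction Hu as [|i u v Hu _ IH]; [exact Hw|].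
  exact (product_mul C i u (fun x => v (w x)) Hu IH).
Qed.

Lemma product_inverse {X} (C : nat -> (X -> X) -> Prop) :
  (forall i u, C i u -> exists u', C i u' /\ forall x, u (u' x) = x /\ u' (u x) = x) ->
  forall u, product C u ->
    exists u', product C u' /\ forall x, u (u' x) = x /\ u' (u x) = x.
Proof.
  intros C_inverse; induction 1 as [|i u w Hu _ (w' & Hw' & Ew)].
  - exists (fun x => x); split; [apply product_id | auto].
  - destruct (C_inverse i u Hu) as (u' & Hu' & Eu).
    exists (fun x => w' (u' x)); split.
    + apply product_comp; [exact Hw'|].
      exact (product_mul C i u' (fun x => x) Hu' (product_id C)).
    + intros x; split.
      * rewrite (proj1 (Ew _)); apply Eu.
      * rewrite (proj2 (Eu _)); apply Ew.
Qed.

Theorem theorem4p6 : ~ T_invariably_generated.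
Proof.
  intros (S & HS & Hgen).
  (* Elements with equal codes coincide, so each element of [S] owns its arc. *)
  set (code := fun s => epsilon (inhabits 0%nat) (fun c => describes c s)).
  assert (Hcode : forall s, S s -> describes (code s) s)
    by (intros s Hs; apply epsilon_spec, describes_exists, HS, Hs).
  set (good := fun s g => ThompsonT g /\ forall u v, cyclic s v ->
    (forall x, g (u x) = v (g x)) ->
    u = (fun x => x) \/ forall x, ~ arc (code s) x -> arc (code s) (u x)).
  set (g := fun s => epsilon (inhabits (fun x : S1 => x)) (good s)).
  assert (Hg : forall s, S s -> good s (g s)).
  { intros s Hs; apply epsilon_spec, exists_pingpong_conjugator, HS, Hs. }
  (* For [n] the code of an element [s] of [S], this is the cyclic group of [s] conjugated by [g s];
     for other [n] it is empty. *)
  set (C := fun n u => exists s v, S s /\ code s = n /\ ThompsonT u /\ cyclic s v /\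
    forall x, g s (u x) = v (g s x)).
  assert (C_comp : forall i u v, C i u -> C i v -> C i (fun x => u (v x))).
  { intros i u v (s & a & Hs & <- & Hu & Ha & Eu) (s' & b & Hs' & Ec & Hv & Hb & Ev).
    assert (s' = s) as ->.
    { apply (describes_unique (code s)); [rewrite <- Ec|]; auto. }
    exists s, (fun x => a (b x)); repeat split; auto.
    - apply ThompsonT_comp; auto.
    - apply cyclic_comp; auto.
    - intros x; rewrite Eu, Ev; reflexivity. }
  assert (C_inv : forall i u, C i u ->
    exists u', C i u' /\ forall x, u (u' x) = x /\ u' (u x) = x).
  { intros i u (s & v & Hs & Hc & Hu & Hv & Eu).
    destruct (ThompsonT_inverse u Hu) as (u' & Hu' & E).
    destruct (ThompsonT_inverse (g s) (proj1 (Hg s Hs))) as (h & _ & Eh).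
    exists u'; split; [|exact E].
    exists s, (fun x => g s (u' (h x))); repeat split; auto.
    - apply (cyclic_inverse s v); auto; intros x.
      rewrite <- Eu, (proj1 (E _)); apply Eh.
    - intros x; rewrite (proj2 (Eh _)); reflexivity. }
  assert (C_pp : forall i u, C i u ->
    u = (fun x => x) \/ forall x, ~ arc i x -> arc i (u x)).
  { intros i u (s & v & Hs & <- & Hu & Hv & Eu).
    exact (proj2 (Hg s Hs) u v Hv Eu). }
  assert (Hsub : is_subgroup (product C)).
  { repeat split.
    - intros f Hf; induction Hf as [|i u w (s & v & _ & _ & Hu & _) _ IH].
      + apply ThompsonT_id.
      + apply ThompsonT_comp; auto.
    - apply product_id.
    - apply product_comp.
    - apply (product_inverse C C_inv). }
  assert (Hsq : product C squeezeS).
  { apply (Hgen g (fun s Hs => proj1 (Hg s Hs)) squeezeS); auto.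
    - apply ThompsonT_circ, PL_squeeze_lift.
    - intros c (s & Hs & Hc & Econj).
      apply (product_mul C (code s) c (fun x => x)); [|apply product_id].
      exists s, s; repeat split; auto; apply cyclic_gen. }
  assert (Hout : forall j x, val x < 1 / 2 -> ~ arc j x).
  { unfold arc; intros j x Hx.
    pose proof (inv_pow2_le 1 (Datatypes.S j) ltac:(lia)) as H; simpl (2 ^ 1) in H.
    lra. }
  assert (Hz : val zeroS < 1 / 2) by (change (val zeroS) with 0; lra).
  destruct (product_maps C arc squeezeS zeroS C_comp arc_disjoint C_pp Hsq
    (fun j => Hout j zeroS Hz)) as [E|[i Hi]].
  (* The identity is excluded at [1/4], which [squeeze] sends to [1/8]. *)
  - assert (Hq : 0 <= 1 / 4 < 1) by lra.
    set (q := exist (fun r => 0 <= r < 1) _ Hq : S1).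
    assert (Eq : squeeze (1 / 4) = 1 / 4).
    { change (squeeze (val q) = val q); rewrite <- val_squeezeS, E; reflexivity. }
    revert Eq; squeeze_cases.
  (* [squeezeS] fixes [0], which lies in no arc. *)
  - apply (Hout i (squeezeS zeroS)) in Hi; auto.
    rewrite val_squeezeS; change (val zeroS) with 0; squeeze_cases.
Qed.
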